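(* Let $f:[0,1]\to\mathbb{E}^1$ be a continuous fuzzy-valued function satisfying the following conditions: (1) the gH-difference $f(x)\circleddash_{gH} f(y)$ exists in $\mathbb{E}^1$ for all $0\le x<y\le 1$; (2) $f(y)\subseteq f(x)$ for all $x,y\in[0,1]$ with $x\le y$. Then, for all positive integers $n$, $$E_{n,f}\le 2\,\omega^{\mathcal F}\left(f,\frac1n\right).$$
   Context: Fuzzy numbers. $\mathbb{E}^1$ is the set of functions $u:\mathbb{R}\to[0,1]$ that are normal ($u(x_0)=1$ for some $x_0\in\mathbb{R}$), convex ($u(\lambda x+(1-\lambda)y)\ge\min\{u(x),u(y)\}$ for all $x,y\in\mathbb{R}$, $\lambda\in[0,1]$), upper semicontinuous, and such that $[u]_0:=\overline{\{x\in\mathbb{R}:u(x)>0\}}$ is compact. For $\alpha\in(0,1]$ put $[u]_\alpha:=\{x\in\mathbb{R}:u(x)\ge\alpha\}$. Each $[u]_\alpha$, $\alpha\in[0,1]$, is a compact interval, written $[u_\alpha^-,u_\alpha^+]$. Addition and multiplication by a scalar $k\in\mathbb{R}$ in $\mathbb{E}^1$ are defined level-wise: $[u+v]_\alpha=[u]_\alpha+[v]_\alpha$ (Minkowski sum), $[ku]_\alpha=k[u]_\alpha$. Metric. $d_\infty(u,v):=\sup_{\alpha\in[0,1]}\max\{|u_\alpha^--v_\alpha^-|,|u_\alpha^+-v_\alpha^+|\}$. $C([0,1],\mathbb{E}^1)$ is the set of functions $[0,1]\to\mathbb{E}^1$ continuous with respect to $d_\infty$, with the metric $D(f,g):=\sup_{x\in[0,1]}d_\infty(f(x),g(x))$.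 Fuzzy inclusion. $u\subseteq v$ means $[u]_\alpha\subseteq[v]_\alpha$ for all $\alpha\in[0,1]$. gH-difference. For $u,v\in\mathbb{E}^1$, the generalized Hukuhara difference $u\circleddash_{gH}v$ is the fuzzy number $w\in\mathbb{E}^1$, if it exists, such that either $u=v+w$ or $v=u+(-1)w$. Modulus of continuity. $\omega^{\mathcal F}(f,\delta):=\sup\{d_\infty(f(x),f(y)): x,y\in[0,1],\ |x-y|<\delta\}$. Approximation error. $\mathfrak{F}_n:=\left\{\sum_{i=0}^n\psi_i(x)u_i:\ \psi_i\in C([0,1],[0,1]),\ u_i\in\mathbb{E}^1,\ i=0,1,\dots,n\right\}$ (viewed as functions of $x\in[0,1]$ with values in $\mathbb{E}^1$), and $E_{n,f}:=\inf_{g\in\mathfrak{F}_n}D(f,g)$. *)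

(* Defs.v *)
From mathcomp Require Import all_boot all_order all_algebra.
From mathcomp Require Import all_classical all_reals all_analysis.
From mathcomp Require Import ring lra.

Set Implicit Arguments.
Unset Strict Implicit.
Unset Printing Implicit Defensive.
Import Order.TTheory GRing.Theory Num.Theory.
Import numFieldNormedType.Exports.
Local Open Scope classical_set_scope.
Local Open Scope ring_scope.

(* Only meant for levels a in [0, 1]. *)
Definition level (R : realType) (u : R -> R) (a : R) : set R :=
  if a == 0 then closure [set x | 0 < u x] else [set x | a <= u x].

Record is_fuzzy (R : realType) (u : R -> R) : Prop := IsFuzzy {
  fuzzy_itv : forall x, 0 <= u x <= 1 ;
  fuzzy_normal : exists x, u x = 1 ;
  fuzzy_convex : forall x y l : R, 0 <= l <= 1 ->
    Num.min (u x) (u y) <= u (l * x + (1 - l) * y) ;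
  (* The library only has lower semicontinuity; u is upper semicontinuous
     when - u is lower semicontinuous. *)
  fuzzy_usc : lower_semicontinuous (fun x => (- u x)%:E) ;
  fuzzy_compact : compact (level u 0) }.

Record fuzzy (R : realType) : Type := Fuzzy {
  fuzzy_fun :> R -> R ;
  fuzzyP : is_fuzzy fuzzy_fun }.

(* The families of sets that are level sets of a fuzzy number. *)
Record level_family (R : realType) (L : R -> set R) : Prop := LevelFamily {
  lf_normal : L 1 !=set0 ;
  lf_itv : forall a, 0 < a <= 1 -> is_interval (L a) ;
  lf_closed : forall a, 0 < a <= 1 -> closed (L a) ;
  lf_anti : forall a b, 0 < a -> a <= b -> b <= 1 -> L b `<=` L a ;
  lf_left : forall a x, 0 < a <= 1 ->
    (forall b, 0 < b < a -> L b x) -> L a x ;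
  lf_supp : L 0 = closure [set x | exists2 a, 0 < a <= 1 & L a x] ;
  lf_compact : compact (L 0) }.

Definition level_fun (R : realType) (L : R -> set R) (x : R) : R :=
  sup (0 |` [set a | 0 < a <= 1 /\ L a x]).

Section LevelFun.
Variables (R : realType) (L : R -> set R).
Hypothesis LF : level_family L.

Lemma level_fun_has_sup x : has_sup (0 |` [set a | 0 < a <= 1 /\ L a x]).
Proof.
split; first by exists 0; left.
by exists 1 => a [->|[/andP[_ ->]]] //; rewrite ler01.
Qed.

Lemma level_funP a x : 0 < a <= 1 -> (a <= level_fun L x) <-> L a x.
Proof.
move=> a01; split=> [lea|Lax]; last first.
  apply: ub_le_sup; first by have [] := level_fun_has_sup x.
  by right.
apply: (lf_left LF) => // b /andP[b0 ba].
have ltb : b < level_fun L x by exact: lt_le_trans ba lea.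
have [c cS bc] := sup_gt (level_fun_has_sup x).1 ltb.
case: cS => [c0|[/andP[c0 c1] Lc]]; first by move: bc; rewrite c0 ltNge ltW.
exact: (lf_anti LF b0 (ltW bc) c1).
Qed.

Lemma level_fun01 x : 0 <= level_fun L x <= 1.
Proof.
have [S0 Sb] := level_fun_has_sup x.
apply/andP; split; first by apply: ub_le_sup => //; left.
apply: ge_sup => // a [->|[/andP[_ ->]]] //; exact: ler01.
Qed.

Lemma level_fun_gt0 :
  [set x | 0 < level_fun L x] = [set x | exists2 a, 0 < a <= 1 & L a x].
Proof.
apply/seteqP; split=> x /=.
  move=> h; exists (level_fun L x).
    by have /andP[_ ->] := level_fun01 x; rewrite h.
  by apply/level_funP => //; have /andP[_ ->] := level_fun01 x; rewrite h.
move=> [a a01 /level_funP -/(_ a01)]; apply: lt_le_trans.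
by case/andP: a01.
Qed.

Lemma level_level_fun a : 0 <= a <= 1 -> level (level_fun L) a = L a.
Proof.
move=> /andP[a0 a1]; rewrite /level; case: eqVneq => [->|an0].
  by rewrite level_fun_gt0 (lf_supp LF).
have a01 : 0 < a <= 1 by rewrite lt_neqAle eq_sym an0 a0.
by apply/seteqP; split=> x /level_funP; apply.
Qed.

Lemma is_fuzzy_level_fun : is_fuzzy (level_fun L).
Proof.
split.
- exact: level_fun01.
- have [x L1] := lf_normal LF; exists x; apply/eqP; rewrite eq_le.
  have /andP[_ -> /=] := level_fun01 x.
  by apply/level_funP => //; rewrite ltr01 lexx.
- move=> x y l /andP[l0 l1]; set m := Num.min _ _.
  have [m0|m0] := leP m 0.
    by apply: le_trans m0 _; case/andP: (level_fun01 (l * x + (1 - l) * y)).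
  have m01 : 0 < m <= 1.
    by rewrite m0 ge_min; case/andP: (level_fun01 x) => _ ->.
  have Lx : L m x by apply/level_funP => //; rewrite ge_min lexx.
  have Ly : L m y by apply/level_funP => //; rewrite ge_min lexx orbT.
  apply/level_funP => //.
  have [xy|/ltW yx] := leP x y.
    by apply: (lf_itv LF m01 Lx Ly); apply/andP; split; nra.
  by apply: (lf_itv LF m01 Ly Lx); apply/andP; split; nra.
- apply/lower_semicontinuousP => a.
  have -> : [set x | (a%:E < (- level_fun L x)%:E)%E] =
            ~` [set x | - a <= level_fun L x].
    apply/seteqP; split=> x /=; rewrite lte_fin ltrNr => h; last first.
      by rewrite ltNge; apply/negP.
    by apply/negP; rewrite -ltNge.
  rewrite openC.
  have [a0|a0] := leP (- a) 0.
    rewrite (_ : [set _ | _] = setT); first exact: closedT.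
    apply/seteqP; split=> // x _ /=.
    by apply: le_trans a0 _; case/andP: (level_fun01 x).
  have [a1|a1] := leP (- a) 1; last first.
    rewrite (_ : [set _ | _] = set0); first exact: closed0.
    apply/seteqP; split=> // x /=.
    by case/andP: (level_fun01 x) => _ h1 /le_trans/(_ h1); rewrite leNgt a1.
  have a01 : 0 < - a <= 1 by rewrite a0.
  rewrite (_ : [set _ | _] = L (- a)); first exact: (lf_closed LF a01).
  by apply/seteqP; split=> x /level_funP; apply.
- by rewrite level_level_fun ?lexx ?ler01//; exact: (lf_compact LF).
Qed.

End LevelFun.

Definition fuzzy_of_levels (R : realType) (L : R -> set R)
  (h : level_family L) : fuzzy R := Fuzzy (is_fuzzy_level_fun h).

Lemma level_fuzzy_of_levels (R : realType) (L : R -> set R)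
    (h : level_family L) a :
  0 <= a <= 1 -> level (fuzzy_of_levels h) a = L a.
Proof. exact: level_level_fun. Qed.

Section LevelTheory.
Variables (R : realType) (u : fuzzy R).

Lemma level_pos a : 0 < a -> level u a = [set x | a <= u x].
Proof. by rewrite /level; case: eqVneq => // ->; rewrite ltxx. Qed.

Lemma level0 : level u 0 = closure [set x | 0 < u x].
Proof. by rewrite /level eqxx. Qed.

Lemma level_anti a b : 0 <= a -> a <= b -> level u b `<=` level u a.
Proof.
move=> a0 ab; have [b0|b0] := leP b 0.
  by have -> : a = b by apply/eqP; rewrite eq_le ab (le_trans b0 a0).
rewrite level_pos//; move: a0; rewrite le_eqVlt => /predU1P[<-|a0].
  by rewrite level0 => x /= bx; apply: subset_closure => /=; exact: lt_le_trans bx.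
by rewrite level_pos// => x; exact: le_trans.
Qed.

Lemma level_closed a : 0 <= a -> closed (level u a).
Proof.
rewrite le_eqVlt => /predU1P[<-|a0]; first by rewrite level0; exact: closed_closure.
rewrite level_pos// -openC.
have /lower_semicontinuousP/(_ (- a)) := fuzzy_usc (fuzzyP u).
congr open; apply/seteqP; split=> x /=; rewrite lte_fin ltrN2 => h.
  by apply/negP; rewrite -ltNge.
by rewrite ltNge; apply/negP.
Qed.

Lemma level_compact a : 0 <= a -> compact (level u a).
Proof.
move=> a0; apply: (subclosed_compact (level_closed a0) (fuzzy_compact (fuzzyP u))).
exact: level_anti.
Qed.

Lemma level_neq0 a : 0 <= a <= 1 -> level u a !=set0.
Proof.
move=> /andP[a0 a1]; have [x ux] := fuzzy_normal (fuzzyP u).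
exists x; apply: (level_anti a0 a1).
by rewrite level_pos ?ltr01//= ux.
Qed.

Lemma level_itv a : 0 < a -> is_interval (level u a).
Proof.
move=> a0; rewrite level_pos// => x y /= ax ay z /andP[xz zy].
move: xz; rewrite le_eqVlt => /predU1P[<-//|xz].
have xy : x < y by exact: lt_le_trans zy.
have yx0 : y - x != 0 by rewrite subr_eq0 gt_eqF.
have l01 : 0 <= (y - z) / (y - x) <= 1.
  rewrite divr_ge0 ?subr_ge0 ?(ltW xy)//= ler_pdivrMr ?subr_gt0// mul1r.
  by rewrite lerD2l lerN2 ltW.
have := fuzzy_convex (fuzzyP u) x y l01.
rewrite (_ : _ + _ = z); last by field.
by apply: le_trans; rewrite le_min ax ay.
Qed.

Lemma level_left a x : 0 < a ->
  (forall b, 0 < b < a -> level u b x) -> level u a x.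
Proof.
move=> a0 h; rewrite level_pos//= leNgt; apply/negP => ua.
have u0 : 0 <= u x by case/andP: (fuzzy_itv (fuzzyP u) x).
have /h : 0 < (u x + a) / 2 < a by apply/andP; split; lra.
by rewrite level_pos/=; lra.
Qed.

Lemma level0_pos :
  level u 0 = closure [set x | exists2 a, 0 < a <= 1 & level u a x].
Proof.
rewrite level0; congr closure; apply/seteqP; split=> x /=.
  move=> ux; exists (u x); last by rewrite level_pos//=.
  by rewrite ux; case/andP: (fuzzy_itv (fuzzyP u) x).
by move=> [a /andP[a0 _]]; rewrite level_pos//=; exact: lt_le_trans.
Qed.

End LevelTheory.

Definition minkowski (R : realType) (A B : set R) : set R :=
  [set x + y | x in A & y in B].

Definition dilation (R : realType) (k : R) (A : set R) : set R :=
  [set k * x | x in A].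

Lemma minkowski_compact (R : realType) (A B : set R) :
  compact A -> compact B -> compact (minkowski A B).
Proof.
move=> cA cB.
have -> : minkowski A B = (fun z : R * R => z.1 + z.2) @` (A `*` B).
  apply/seteqP; split=> z /=.
    by move=> [x Ax [y By <-]]; exists (x, y).
  by move=> [[x y] [/= Ax By] <-]; exists x => //; exists y.
apply: continuous_compact; last exact: compact_setX.
by apply: continuous_subspaceT => -[x y]; exact: add_continuous.
Qed.

Lemma level_family_add (R : realType) (u v : fuzzy R) :
  level_family (fun a => minkowski (level u a) (level v a)).
Proof.
have c (a : R) : 0 <= a -> compact (minkowski (level u a) (level v a)).
  by move=> a0; apply: minkowski_compact; exact: level_compact.
have cl (a : R) : 0 <= a -> closed (minkowski (level u a) (level v a)).
  by move=> a0; apply: compact_closed; [exact: Rhausdorff | exact: c].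
have anti (a b : R) : 0 <= a -> a <= b ->
    minkowski (level u b) (level v b) `<=` minkowski (level u a) (level v a).
  move=> a0 ab _ [x ux [y vy <-]].
  exists x; first exact: level_anti ux.
  by exists y => //; exact: level_anti vy.
split.
- have i1 : 0 <= (1 : R) <= 1 by rewrite ler01 lexx.
  have [x ux] := level_neq0 u i1; have [y vy] := level_neq0 v i1.
  by exists (x + y), x => //; exists y.
- move=> a /andP[a0 _] _ _ [x1 ux1 [y1 vy1 <-]] [x2 ux2 [y2 vy2 <-]] z.
  move=> /andP[z1 z2].
  have iu := level_itv a0 (u := u); have iv := level_itv a0 (u := v).
  have [h|h] := leP z (x2 + y1); last first.
    exists x2 => //; exists (z - x2); last by ring.
    by apply: (iv _ _ vy1 vy2); apply/andP; split; lra.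
  exists (z - y1); last by exists y1 => //; ring.
  by apply: (iu _ _ ux1 ux2); apply/andP; split; lra.
- by move=> a /andP[a0 _]; exact: cl (ltW a0).
- by move=> a b a0 ab _; exact: anti (ltW a0) ab.
- move=> a z /andP[a0 a1] h.
  pose P b y := 0 < b < a -> level u b y /\ level v b (z - y).
  have /choice[s sP] b : exists y, P b y.
    have [b0|nb] := pselect (0 < b < a); last by exists 0.
    have [x ux [y vy xy]] := h b b0; exists x => _; split=> //.
    by rewrite -xy addrAC subrr add0r.
  have near_s b : 0 < b < a ->
      \forall t \near a^'-, level u b (s t) /\ level v b (z - s t).
    move=> /andP[b0 ba]; near=> t.
    have tb : b < t by near: t; exact: nbhs_left_gt.
    have ta : t < a by near: t; exact: nbhs_left_lt.
    have [|ut vt] := sP t; first by rewrite ta (lt_trans b0 tb).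
    by split; [exact: (level_anti (ltW b0) (ltW tb)) ut
             | exact: (level_anti (ltW b0) (ltW tb)) vt].
  have [|p [_ clp]] :=
      level_compact (u := u) (lexx 0) (F := s @ a^'-) _.
    have a2 : 0 < a / 2 < a by apply/andP; split; lra.
    apply: filterS (near_s _ a2) => t [ut _].
    by apply: level_anti ut; lra.
  have both b : 0 < b < a -> level u b p /\ level v b (z - p).
    move=> b0a; have b0 : 0 <= b by case/andP: b0a => /ltW.
    split.
      apply: (level_closed (u := u) b0) => B pB.
      apply: clp pB; apply: filterS (near_s _ b0a) => t; case=> //.
    have : closed ((fun y => z - y) @^-1` level v b).
      apply: closed_comp (level_closed (u := v) b0) => y _.
      by apply: cvgB; [exact: cvg_cst|exact: cvg_id].
    apply=> B pB; apply: clp pB.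
    by apply: filterS (near_s _ b0a) => t; case.
  exists p; first by apply: level_left => // b /both[].
  by exists (z - p); [apply: level_left => // b /both[] | ring].
- apply/seteqP; split.
    move=> _ [x + [y + <-]]; rewrite !level0 => ux vy B /=.
    have addc : (fun z : R * R => z.1 + z.2) @ (x, y) --> x + y.
      by apply: cvgD; [exact: cvg_fst | exact: cvg_snd].
    move=> /addc [[B1 B2] /= [xB1 yB2]] B12.
    have [x' [/= ux' Bx']] := ux _ xB1; have [y' [/= vy' By']] := vy _ yB2.
    exists (x' + y'); split; last exact: (B12 (x', y')).
    exists (Num.min (u x') (v y')).
      rewrite lt_min ux' vy' ge_min.
      by have /andP[_ ->] := fuzzy_itv (fuzzyP u) x'.
    have m0 : 0 < Num.min (u x') (v y') by rewrite lt_min ux' vy'.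
    exists x'; first by rewrite level_pos//= ge_min lexx.
    by exists y' => //; rewrite level_pos//= ge_min lexx orbT.
  rewrite [X in _ `<=` X](closure_id _).1; last exact: cl.
  apply: closureS => z [a /andP[a0 _]]; exact: anti (ltW a0) _.
- exact: c.
Unshelve. all: by end_near. Qed.

Lemma level_family_scale (R : realType) (k : R) (u : fuzzy R) :
  level_family (fun a => dilation k (level u a)).
Proof.
have kc : continuous ( *%R k : R -> R) by move=> x; exact: mulrl_continuous.
have c (a : R) : 0 <= a -> compact (dilation k (level u a)).
  move=> a0; apply: continuous_compact; last exact: level_compact.
  exact: continuous_subspaceT.
have cl (a : R) : 0 <= a -> closed (dilation k (level u a)).
  by move=> a0; apply: compact_closed; [exact: Rhausdorff | exact: c].
have anti (a b : R) : 0 <= a -> a <= b ->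
    dilation k (level u b) `<=` dilation k (level u a).
  by move=> a0 ab _ [x ux <-]; exists x => //; exact: level_anti ux.
split.
- have i1 : 0 <= (1 : R) <= 1 by rewrite ler01 lexx.
  by have [x ux] := level_neq0 u i1; exists (k * x), x.
- move=> a /andP[a0 _] _ _ [x1 ux1 <-] [x2 ux2 <-] z /andP[z1 z2].
  have iu := level_itv a0 (u := u).
  have zk : k != 0 -> k * (z / k) = z by move=> k0; field.
  have [k0|k0|k0] := ltgtP k 0.
  + exists (z / k); last by rewrite zk// lt_eqF.
    apply: (iu _ _ ux2 ux1); rewrite ler_ndivlMr// ler_ndivrMr//.
    by rewrite ![_ * k]mulrC z1 z2.
  + exists (z / k); last by rewrite zk// gt_eqF.
    apply: (iu _ _ ux1 ux2); rewrite ler_pdivlMr// ler_pdivrMr//.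
    by rewrite ![_ * k]mulrC z1 z2.
  + exists x1 => //; move: z1 z2; rewrite k0 !mul0r => z1 z2.
    by apply/eqP; rewrite eq_le z1 z2.
- by move=> a /andP[a0 _]; exact: cl (ltW a0).
- by move=> a b a0 ab _; exact: anti (ltW a0) ab.
- move=> a z /andP[a0 a1] h.
  have [k0|k0] := eqVneq k 0.
    have i : 0 <= a <= 1 by rewrite ltW.
    have [x ux] := level_neq0 u i.
    have [|y _ <-] := h (a / 2); first by apply/andP; split; lra.
    by exists x; rewrite // k0 !mul0r.
  exists (z / k); last by field.
  apply: level_left => // b b0; have [x ux <-] := h b b0.
  by rewrite (_ : _ / _ = x)//; field.
- apply/seteqP; split.
    move=> _ [x + <-]; rewrite level0 => ux B /= /kc xB.
    have [x' [/= ux' Bx']] := ux _ xB.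
    exists (k * x'); split => //; exists (u x').
      by rewrite ux'; have /andP[_ ->] := fuzzy_itv (fuzzyP u) x'.
    by exists x' => //; rewrite level_pos//=.
  rewrite [X in _ `<=` X](closure_id _).1; last exact: cl.
  apply: closureS => z [a /andP[a0 _]]; exact: anti (ltW a0) _.
- exact: c.
Qed.

Lemma level_family_crisp (R : realType) (c : R) :
  level_family (fun=> [set c]).
Proof.
have cl : closed [set c].
  by apply: compact_closed; [exact: Rhausdorff | exact: compact_set1].
split.
- by exists c.
- by move=> a _ x y -> -> z /= /andP[cz zc]; apply/eqP; rewrite eq_le zc cz.
- by [].
- by move=> a b _ _ _ x.
- by move=> a x /andP[a0 _] h; apply: (h (a / 2)); apply/andP; split; lra.
- rewrite (_ : [set _ | _] = [set c]); last first.
    apply/seteqP; split=> x /=; first by case.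
    by exists 1; rewrite // ltr01 lexx.
  by rewrite -(closure_id _).1.
- exact: compact_set1.
Qed.

(* Addition and scalar multiplication are level-wise: see level_fadd and
   level_fscale. *)
Definition fadd (R : realType) (u v : fuzzy R) : fuzzy R :=
  fuzzy_of_levels (level_family_add u v).

Definition fscale (R : realType) (k : R) (u : fuzzy R) : fuzzy R :=
  fuzzy_of_levels (level_family_scale k u).

(* The indicator function of {0}, the neutral element of fadd. *)
Definition fzero (R : realType) : fuzzy R :=
  fuzzy_of_levels (level_family_crisp (0 : R)).
Arguments fzero {R}.

Lemma level_fadd (R : realType) (u v : fuzzy R) (a : R) : 0 <= a <= 1 ->
  level (fadd u v) a = minkowski (level u a) (level v a).
Proof. exact: level_fuzzy_of_levels. Qed.

Lemma level_fscale (R : realType) (k : R) (u : fuzzy R) (a : R) :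
  0 <= a <= 1 -> level (fscale k u) a = dilation k (level u a).
Proof. exact: level_fuzzy_of_levels. Qed.

Lemma level_fzero (R : realType) (a : R) : 0 <= a <= 1 ->
  level (@fzero R) a = [set 0].
Proof. exact: level_fuzzy_of_levels. Qed.

Lemma fuzzy_eq (R : realType) (u v : fuzzy R) :
  (forall a, 0 <= a <= 1 -> level u a = level v a) -> u = v.
Proof.
case: u v => u up [v vp] /= h.
suff uv : u = v by subst v; congr Fuzzy; exact: Prop_irrelevance.
apply/funext => x.
have le (f g : R -> R) : is_fuzzy f -> is_fuzzy g ->
    (forall a, 0 <= a <= 1 -> level f a = level g a) -> f x <= g x.
  move=> fp gp fg; have /andP[f0 f1] := fuzzy_itv fp x.
  move: f0; rewrite le_eqVlt => /predU1P[<-|f0].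
    by have /andP[] := fuzzy_itv gp x.
  have : level f (f x) x by rewrite /level gt_eqF//=.
  by rewrite fg ?(ltW f0)// /level gt_eqF.
by apply/eqP; rewrite eq_le !le// => a a01; rewrite h.
Qed.

Lemma fadd0 (R : realType) (u : fuzzy R) : fadd u fzero = u.
Proof.
apply: fuzzy_eq => a a01; rewrite level_fadd// level_fzero//.
apply/seteqP; split=> [_ [x ux [_ /= -> <-]]|x ux]; first by rewrite addr0.
by exists x => //; exists 0 => //; rewrite addr0.
Qed.

Definition fsubset (R : realType) (u v : fuzzy R) : Prop :=
  forall a, 0 <= a <= 1 -> level u a `<=` level v a.

Definition gH_difference (R : realType) (u v w : fuzzy R) : Prop :=
  u = fadd v w \/ v = fadd u (fscale (- 1) w).

Definition lower_end (R : realType) (u : fuzzy R) (a : R) : R :=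
  inf (level u a).
Definition upper_end (R : realType) (u : fuzzy R) (a : R) : R :=
  sup (level u a).

Lemma level_ends (R : realType) (u : fuzzy R) (a : R) : 0 <= a <= 1 ->
  level u a = [set x | lower_end u a <= x <= upper_end u a].
Proof.
move=> a01; have a0 : 0 <= a by case/andP: a01.
have itv : is_interval (level u a).
  move: a0; rewrite le_eqVlt => /predU1P[<-|]; last exact: level_itv.
  rewrite level0; apply/connected_intervalP/connected_closure.
  apply/connected_intervalP => x y /= ux uy z xyz.
  have m0 : 0 < Num.min (u x) (u y) by rewrite lt_min ux uy.
  apply: (lt_le_trans m0).
  have := level_itv m0 (u := u); rewrite level_pos// => h.
  by apply: (h x y) xyz => /=; rewrite ge_min lexx ?orbT.
have ne := level_neq0 u a01; have cp := level_compact (u := u) a0.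
have [M [_ Mb]] := compact_bounded cp.
have bd x : level u a x -> `|x| <= M + 1 by apply: Mb; rewrite ltrDl.
have hs : has_sup (level u a).
  by split=> //; exists (M + 1) => x /bd; rewrite ler_norml => /andP[].
have hi : has_inf (level u a).
  by split=> //; exists (- (M + 1)) => x /bd; rewrite ler_norml => /andP[].
apply/seteqP; split=> x /=.
  by move=> ux; rewrite ge_inf ?ub_le_sup//; [case: hs|case: hi].
apply: itv.
  have /closure_id -> := level_closed (u := u) a0.
  move=> B /nbhs_ballP[e /= e0 eB].
  have [z uz ze] := inf_adherent e0 hi; exists z; split=> //; apply: eB.
  have zi : inf (level u a) <= z by apply: ge_inf => //; case: hi.
  by rewrite /ball /= ltr_distlC; apply/andP; split; lra.
have /closure_id -> := level_closed (u := u) a0.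
by apply: closure_sup => //; case: hs.
Qed.

(* Suprema and infima are taken in \bar R, so that none of them is a junk
   value; they are all finite for f continuous on [0, 1]. *)
Definition d_infty (R : realType) (u v : fuzzy R) : \bar R :=
  ereal_sup [set (Num.max `|lower_end u a - lower_end v a|
                          `|upper_end u a - upper_end v a|)%:E
            | a in `[0, 1]].

(* Functions on [0, 1] are represented by functions on R whose values outside
   [0, 1] are never used. *)
Definition fcontinuous01 (R : realType) (f : R -> fuzzy R) : Prop :=
  forall x, x \in `[0, 1] -> forall e : R, 0 < e ->
    exists2 d : R, 0 < d &
      forall y, y \in `[0, 1] -> `|x - y| < d ->
        (d_infty (f x) (f y) < e%:E)%E.

Definition fdist (R : realType) (f g : R -> fuzzy R) : \bar R :=
  ereal_sup [set d_infty (f x) (g x) | x in `[0, 1]].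

Definition fmodulus (R : realType) (f : R -> fuzzy R) (d : R) : \bar R :=
  ereal_sup [set z | exists x y : R,
    [/\ x \in `[0, 1], y \in `[0, 1], `|x - y| < d
      & z = d_infty (f x) (f y)]].

Definition approx_family (R : realType) (n : nat) : set (R -> fuzzy R) :=
  [set g | exists (psi : 'I_n.+1 -> R -> R) (u : 'I_n.+1 -> fuzzy R),
    [/\ forall i, {within `[0, 1], continuous (psi i)},
        forall i x, x \in `[0, 1] -> psi i x \in `[0, 1]
      & g = fun x => \big[@fadd R/fzero]_(i < n.+1) fscale (psi i x) (u i)]].
Arguments approx_family : clear implicits.

Definition approx_error (R : realType) (n : nat) (f : R -> fuzzy R) : \bar R :=
  ereal_inf [set fdist f g | g in approx_family R n].

(* Main.v *)
Require Import Defs.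
From mathcomp Require Import all_boot all_order all_algebra.
From mathcomp Require Import all_classical all_reals all_analysis.
From mathcomp Require Import ring lra.
Import Order.TTheory GRing.Theory Num.Theory.
Import numFieldNormedType.Exports.
Local Open Scope ring_scope.

(** With nodes [x_i = i / n], conditions (1) and (2) give Hukuhara differences
    [f(x_i) = f(x_(i+1)) + w_i].  Put [w_n = f(1)] and let [psi_i] be [1] up to
    [x_i], [0] from [x_(i+1)] on, and affine in between.  On
    [[x_k, x_(k+1)]] the sum [g = \sum_i psi_i w_i] telescopes to
    [f(x_(k+1)) + psi_k w_k], so the endpoints of the levels of [g(x)], like
    those of [f(x)], lie between those of [f(x_k)] and [f(x_(k+1))].  Since
    the modulus only sees distances strictly below [1/n], the last two values
    are compared through the midpoint of the nodes, whence the factor [2]. *)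

(** * Endpoints of level intervals under the fuzzy operations and the metric *)

Section Ends.
Set Implicit Arguments.
Unset Strict Implicit.
Context {R : realType}.
Implicit Types (u v w : fuzzy R) (a k p q : R).

Lemma lower_le_upper u a : 0 <= a <= 1 -> lower_end u a <= upper_end u a.
Proof.
move=> a01; have [x] := level_neq0 u a01.
by rewrite level_ends//= => /andP[]; exact: le_trans.
Qed.

(** [p], [q] and the two ends all lie in both descriptions of the level, and comparing them forces
    equality. The endpoint formulas below follow by exhibiting a level as an interval. *)
Lemma ends_unique u a p q : 0 <= a <= 1 -> p <= q ->
  level u a = [set x | p <= x <= q]%classic ->
  lower_end u a = p /\ upper_end u a = q.
Proof.
move=> a01 pq; rewrite level_ends// => /seteqP[s1 s2].
have lu := lower_le_upper u a01.
have /andP[l1 _] := s1 (lower_end u a) (introT andP (conj (lexx _) lu)).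
have /andP[_ u1] := s1 (upper_end u a) (introT andP (conj lu (lexx _))).
have /andP[l2 _] := s2 p (introT andP (conj (lexx _) pq)).
have /andP[_ u2] := s2 q (introT andP (conj pq (lexx _))).
by split; apply/le_anti/andP.
Qed.

Lemma ends_fadd u v a : 0 <= a <= 1 ->
  lower_end (fadd u v) a = lower_end u a + lower_end v a /\
  upper_end (fadd u v) a = upper_end u a + upper_end v a.
Proof.
move=> a01; have lu := lower_le_upper u a01; have lv := lower_le_upper v a01.
apply: ends_unique => //; first exact: lerD.
rewrite level_fadd// !level_ends//; apply/seteqP; split.
  by move=> _ [x /= /andP[? ?] [y /= /andP[? ?] <-]]; rewrite !lerD.
move=> z /= /andP[z1 z2].
(* To split [z], [v] contributes its lower end as long as the rest stays below the upper end of [u];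
   otherwise [u] contributes its upper end. *)
have [h|h] := leP (z - lower_end v a) (upper_end u a).
  exists (z - lower_end v a); first by apply/andP; split; lra.
  by exists (lower_end v a); [apply/andP; split; lra|ring].
exists (upper_end u a); first by apply/andP; split; lra.
by exists (z - upper_end u a); [apply/andP; split; lra|ring].
Qed.

Lemma ends_fscale k u a : 0 <= k -> 0 <= a <= 1 ->
  lower_end (fscale k u) a = k * lower_end u a /\
  upper_end (fscale k u) a = k * upper_end u a.
Proof.
move=> k0 a01; have lu := lower_le_upper u a01.
apply: ends_unique => //; first exact: ler_wpM2l.
rewrite level_fscale// level_ends//; apply/seteqP; split.
  by move=> _ [x /= /andP[? ?] <-]; rewrite !ler_wpM2l.
(* The preimage [z / k] requires a nonzero [k]; at [k = 0] both bounds on [z] are 0 and any point of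
   the level serves. *)
move=> z /= /andP[z1 z2]; move: k0; rewrite le_eqVlt => /predU1P[k0|k0].
  exists (lower_end u a); first by rewrite /= lexx lu.
  by apply/le_anti; move: z1 z2; rewrite -k0 !mul0r => -> ->.
exists (z / k); last by field; rewrite gt_eqF.
by rewrite /= ler_pdivlMr// ler_pdivrMr// ![_ * k]mulrC z1 z2.
Qed.

(** A negative factor swaps the ends, hence a separate lemma; [- 1] is the factor in the second form
    of the gH-difference. *)
Lemma ends_fopp u a : 0 <= a <= 1 ->
  lower_end (fscale (- 1) u) a = - upper_end u a /\
  upper_end (fscale (- 1) u) a = - lower_end u a.
Proof.
move=> a01; have lu := lower_le_upper u a01.
apply: ends_unique => //; first by rewrite lerN2.
rewrite level_fscale// level_ends//; apply/seteqP; split.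
  by move=> _ [x /= /andP[? ?] <-]; rewrite !mulN1r !lerN2; apply/andP.
move=> z /= /andP[z1 z2]; exists (- z); last by ring.
by apply/andP; split; lra.
Qed.

Lemma ends_fzero a : 0 <= a <= 1 ->
  lower_end (@fzero R) a = 0 /\ upper_end (@fzero R) a = 0.
Proof.
move=> a01; apply: ends_unique => //; rewrite level_fzero//.
apply/seteqP; split=> [x ->|x /= /andP[x1 x2]]; first by rewrite /= lexx.
by apply/le_anti/andP.
Qed.

Lemma ends_fsum (I : Type) (r : seq I) (c : I -> R) (u : I -> fuzzy R) a :
  (forall i, 0 <= c i) -> 0 <= a <= 1 ->
  lower_end (\big[@fadd R/fzero]_(i <- r) fscale (c i) (u i)) a =
    \sum_(i <- r) c i * lower_end (u i) a /\
  upper_end (\big[@fadd R/fzero]_(i <- r) fscale (c i) (u i)) a =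
    \sum_(i <- r) c i * upper_end (u i) a.
Proof.
move=> c0 a01; elim: r => [|i r [IHl IHu]].
  by rewrite !big_nil; exact: ends_fzero.
have [fl fu] := ends_fscale (u i) (c0 i) a01.
by rewrite !big_cons; have [-> ->] := ends_fadd (fscale (c i) (u i))
  (\big[@fadd R/fzero]_(j <- r) fscale (c j) (u j)) a01; rewrite fl fu IHl IHu.
Qed.

Lemma fsubset_ends u v a : 0 <= a <= 1 -> fsubset u v ->
  lower_end v a <= lower_end u a /\ upper_end u a <= upper_end v a.
Proof.
move=> a01 /(_ a a01); rewrite !level_ends// => uv.
have lu := lower_le_upper u a01.
have /andP[l1 _] := uv (lower_end u a) (introT andP (conj (lexx _) lu)).
by have /andP[_ u1] := uv (upper_end u a) (introT andP (conj lu (lexx _))).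
Qed.

(* In the second case of the gH-difference, nestedness forces [w] to be the
   crisp zero, so that the first case holds as well. *)
Lemma gH_difference_ends u v w a : 0 <= a <= 1 -> fsubset v u ->
  gH_difference u v w ->
  lower_end u a = lower_end v a + lower_end w a /\
  upper_end u a = upper_end v a + upper_end w a.
Proof.
move=> a01 vu [->|vE]; first exact: ends_fadd.
have [l1 u1] := fsubset_ends a01 vu; have lw := lower_le_upper w a01.
have [] := ends_fadd u (fscale (- 1) w) a01; rewrite -vE.
by have [-> ->] := ends_fopp w a01 => e1 e2; split; lra.
Qed.

Lemma d_infty_le u v (z : \bar R) :
  (forall a, 0 <= a <= 1 ->
     (`|lower_end u a - lower_end v a|%:E <= z)%E /\
     (`|upper_end u a - upper_end v a|%:E <= z)%E) ->
  (d_infty u v <= z)%E.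
Proof.
move=> h; apply: ge_ereal_sup => _ [a /= a01 <-].
have [|h1 h2] := h a; first by move: a01; rewrite in_itv.
by rewrite EFin_max ge_max h1 h2.
Qed.

Lemma ends_le_d_infty u v a : 0 <= a <= 1 ->
  (`|lower_end u a - lower_end v a|%:E <= d_infty u v)%E /\
  (`|upper_end u a - upper_end v a|%:E <= d_infty u v)%E.
Proof.
move=> a01; set M := Num.max `|lower_end u a - lower_end v a|
                             `|upper_end u a - upper_end v a|.
have hM : (M%:E <= d_infty u v)%E.
  by apply: ereal_sup_ubound; exists a => //=; rewrite in_itv.
by split; apply: le_trans hM; rewrite lee_fin le_max lexx ?orbT.
Qed.

Lemma fmodulus_ub (f : R -> fuzzy R) (d x y : R) :
  x \in `[0, 1] -> y \in `[0, 1] -> `|x - y| < d ->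
  (d_infty (f x) (f y) <= fmodulus f d)%E.
Proof. by move=> x01 y01 xy; apply: ereal_sup_ubound; exists x, y. Qed.

End Ends.

(** * Piecewise affine weights on the uniform grid *)

Section Ramp.
Set Implicit Arguments.
Unset Strict Implicit.
Context {R : realType}.
Implicit Types (n i k : nat) (x : R).

(** For [i = n] the value is 1 on all of [0, 1], so the last weight is constant there. *)
Definition ramp n i x : R := Num.max 0 (Num.min 1 (i.+1%:R - n%:R * x)).

Lemma ramp_itv n i x : 0 <= ramp n i x <= 1.
Proof. by rewrite /ramp le_max lexx/= ge_max ler01 ge_min lexx. Qed.

Lemma ramp_eq1 n i x : n%:R * x <= i%:R -> ramp n i x = 1.
Proof.
move=> h; have : 1 <= i.+1%:R - n%:R * x by rewrite -natr1; lra.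
by rewrite /ramp => /min_idPl ->; apply/max_idPr; exact: ler01.
Qed.

Lemma ramp_eq0 n i x : i.+1%:R <= n%:R * x -> ramp n i x = 0.
Proof. by move=> h; apply/max_idPl; rewrite ge_min; apply/orP; right; lra. Qed.

Lemma ramp_continuous n i : continuous (ramp n i).
Proof.
move=> x.
apply: (@continuous_max _ _ (cst 0) (cst 1 \min (fun x => i.+1%:R - n%:R * x)) x).
  exact: cst_continuous.
apply: (@continuous_min _ _ (cst 1) (fun x => i.+1%:R - n%:R * x)).
  exact: cst_continuous.
apply: cvgB; first exact: cvg_cst.
exact: mulrl_continuous.
Qed.

(** Below [k] the weights vanish; above [k] they are 1 and the differences telescope. [phi] will
    list the lower or the upper ends at the nodes, with [phi n.+1 = 0]. *)
Lemma ramp_sum n k x (phi : nat -> R) : (k < n)%N ->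
  k%:R <= n%:R * x <= k.+1%:R ->
  \sum_(i < n.+1) ramp n i x * (phi i - phi i.+1) =
  phi k.+1 + ramp n k x * (phi k - phi k.+1) - phi n.+1.
Proof.
move=> kn /andP[kx xk].
rewrite -(big_mkord xpredT (fun i => ramp n i x * (phi i - phi i.+1))).
rewrite (big_cat_nat (leq0n k))/=; last exact: leqW (ltnW kn).
rewrite big_nat big1 ?add0r; last first.
  move=> i /andP[_ ik]; rewrite ramp_eq0 ?mul0r//.
  by apply: le_trans kx; rewrite ler_nat.
rewrite big_ltn ?ltnS ?(ltnW kn)//.
rewrite (eq_big_nat _ _ (F2 := fun i => - (phi i.+1 - phi i))).
  by rewrite sumrN telescope_sumr ?ltnS ?(ltnW kn)// opprB addrCA addrA.
move=> i /andP[ki _]; rewrite ramp_eq1 ?mul1r ?opprB//.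
by apply: le_trans xk _; rewrite ler_nat.
Qed.

Lemma node_interval n x : (0 < n)%N -> 0 <= x <= 1 ->
  exists2 k, (k < n)%N & k%:R <= n%:R * x <= k.+1%:R.
Proof.
move=> n0 /andP[x0 x1]; have : n%:R * x <= n%:R by rewrite ler_piMr.
have : 0 <= n%:R * x by rewrite mulr_ge0.
(* Once [n x] is an independent real [y], induction on [n] only asks whether [y] falls in the last
   unit cell. *)
move: (n%:R * x) => y y0; elim: n n0 => // -[_ _|m IH _] ym.
  by exists 0%N => //; rewrite y0.
have [h|h] := leP y m.+1%:R.
  by have [k km kP] := IH isT h; exists k => //; exact: ltnW.
by exists m.+1 => //; rewrite (ltW h).
Qed.

(** Both [s] and the convex combination lie between [a] and [b]. *)
Lemma convex_dist_le (s t a b : R) : 0 <= t <= 1 ->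
  a <= s <= b \/ b <= s <= a -> `|s - (b + t * (a - b))| <= `|a - b|.
Proof.
move=> /andP[t0 t1] [] /andP[h1 h2].
  rewrite [`|a - b|]ler0_norm ?subr_le0 ?(le_trans h1)// ler_norml.
  by apply/andP; split; nra.
rewrite [`|a - b|]ger0_norm ?subr_ge0 ?(le_trans h1)// ler_norml.
by apply/andP; split; nra.
Qed.

End Ramp.

(** * Construction of the approximant and estimate of its error *)

Theorem theorem3p4 (R : realType) (f : R -> fuzzy R)
  (f_cont : fcontinuous01 f)
  (f_gH : forall x y : R, 0 <= x -> x < y -> y <= 1 ->
    exists w : fuzzy R, gH_difference (f x) (f y) w)
  (f_incl : forall x y : R, x \in `[0, 1] -> y \in `[0, 1] -> x <= y ->
    fsubset (f y) (f x))
  (n : nat) (n_gt0 : (0 < n)%N) :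
  (approx_error n f <= 2%:E * fmodulus f (n%:R^-1))%E.
Proof.
have n0 : 0 < n%:R :> R by rewrite ltr0n.
pose node (i : nat) : R := i%:R / n%:R.
have node01 i : (i <= n)%N -> node i \in `[0, 1].
  by move=> i_n; rewrite in_itv/= divr_ge0 ?ler0n//= ler_pdivrMr// mul1r ler_nat.
have node_lt i : node i < node i.+1.
  by rewrite ltr_pM2r ?invr_gt0// ltr_nat.
(* Endpoints of [f (node i)], extended by [0] at [i = n + 1] so that
   [f 1] is the last difference. *)
pose lo a i := if (i <= n)%N then lower_end (f (node i)) a else 0.
pose up a i := if (i <= n)%N then upper_end (f (node i)) a else 0.
(* A single [u i] must serve every level [a]. At [i = n] it is [f (node n)], that is [f 1]; beyond
   [n] it is the default [fzero]. *)
have /choice[u uP] i : exists w : fuzzy R, (i <= n)%N ->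
    forall a, 0 <= a <= 1 ->
    lower_end w a = lo a i - lo a i.+1 /\ upper_end w a = up a i - up a i.+1.
  have [i_n|_|->] := ltngtP i n; last first.
  - exists (f (node n)) => _ a _.
    by rewrite /lo /up leqnn ltnn !subr0.
  - by exists fzero.
  - have := node01 i (ltnW i_n); have := node01 _ i_n.
    move=> t01 s01; have [s0 _] := andP s01; have [_ t1] := andP t01.
    have [w wP] := f_gH _ _ s0 (node_lt i) t1; exists w => _ a a01.
    have sub := f_incl _ _ s01 t01 (ltW (node_lt i)).
    have [el eu] := gH_difference_ends a01 sub wP.
    by rewrite /lo /up i_n (ltnW i_n); split; lra.
pose g x := \big[@fadd R/fzero]_(i < n.+1) fscale (ramp n i x) (u i).
apply: (@le_trans _ _ (fdist f g)).
  apply: ereal_inf_lbound; exists g => //.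
  exists (fun i : 'I_n.+1 => ramp n i), (fun i : 'I_n.+1 => u i); split=> //.
  - by move=> i; apply: continuous_subspaceT; exact: ramp_continuous.
  - by move=> i x _; rewrite in_itv/=; exact: ramp_itv.
apply: ge_ereal_sup => _ [x /= x01 <-]; apply: d_infty_le => a a01.
have [k kn kx] : exists2 k, (k < n)%N & k%:R <= n%:R * x <= k.+1%:R.
  by apply: node_interval => //; move: x01; rewrite in_itv.
have xk : node k <= x <= node k.+1.
  by rewrite ler_pdivrMr// ler_pdivlMr// mulrC.
have [kx1 xk1] := andP xk.
have r0 (i : 'I_n.+1) : 0 <= ramp n i x by case/andP: (ramp_itv n i x).
have [gl gu] : lower_end (g x) a =
    lo a k.+1 + ramp n k x * (lo a k - lo a k.+1) /\
    upper_end (g x) a =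
    up a k.+1 + ramp n k x * (up a k - up a k.+1).
  have [-> ->] := ends_fsum (index_enum 'I_n.+1) (fun i : 'I_n.+1 => u i) r0 a01.
  (* This removes the boundary term [phi n.+1] of [ramp_sum]. *)
  have endE : lo a n.+1 = 0 /\ up a n.+1 = 0 by rewrite /lo /up ltnn.
  have uE (i : 'I_n.+1) := uP i (ltn_ord i : (i <= n)%N) a a01.
  split.
    under eq_bigr => i _ do rewrite (uE i).1.
    by rewrite (ramp_sum _ kn kx) endE.1 subr0.
  under eq_bigr => i _ do rewrite (uE i).2.
  by rewrite (ramp_sum _ kn kx) endE.2 subr0.
rewrite gl gu /lo /up kn (ltnW kn).
have s01 := node01 k (ltnW kn); have t01 := node01 _ kn.
(* Nestedness puts the ends of [f x] between those at the two nodes. *)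
have [l1 u1] := fsubset_ends a01 (f_incl _ _ s01 x01 kx1).
have [l2 u2] := fsubset_ends a01 (f_incl _ _ x01 t01 xk1).
pose m := (node k + node k.+1) / 2.
have stE : node k.+1 = node k + n%:R^-1.
  by rewrite /node -natr1 mulrDl mul1r.
have ni0 : 0 < n%:R^-1 :> R by rewrite invr_gt0.
have m01 : m \in `[0, 1].
  by move: s01 t01; rewrite /m !in_itv/= => /andP[? ?] /andP[? ?]; lra.
have sm : `|node k - m| < n%:R^-1.
  by rewrite /m stE ltr_norml; apply/andP; split; lra.
have mt : `|m - node k.+1| < n%:R^-1.
  by rewrite /m stE ltr_norml; apply/andP; split; lra.
have [ls us] := ends_le_d_infty (f (node k)) (f m) a01.
have [lt ut] := ends_le_d_infty (f m) (f (node k.+1)) a01.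
have hs := @fmodulus_ub _ f _ _ _ s01 m01 sm.
have ht := @fmodulus_ub _ f _ _ _ m01 t01 mt.
have twice (p q r : R) : (`|p - q|%:E <= fmodulus f n%:R^-1)%E ->
    (`|q - r|%:E <= fmodulus f n%:R^-1)%E ->
    (`|p - r|%:E <= 2%:E * fmodulus f n%:R^-1)%E.
  move=> pq qr; rewrite mule_natl mule2n; apply: le_trans (leeD pq qr).
  by rewrite -EFinD lee_fin ler_distD.
(* From [node k] to [node k.+1] lower ends increase and upper ends decrease, hence the opposite
   alternatives of [convex_dist_le]. *)
split.
- apply: le_trans (twice _ _ _ (le_trans ls hs) (le_trans lt ht)).
  by rewrite lee_fin convex_dist_le ?ramp_itv//; left; rewrite l1.
- apply: le_trans (twice _ _ _ (le_trans us hs) (le_trans ut ht)).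
  by rewrite lee_fin convex_dist_le ?ramp_itv//; right; rewrite u2.
Qed.
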